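(* Let $n=p_1^{\alpha_1}\cdots p_k^{\alpha_k}$, where $k\geq 1$, $\alpha_i\geq 1$ and the $p_i$ are distinct primes satisfying $p_i\equiv 1\pmod 4$ for all $i=1,\ldots,k$. For each $i\in\{1,\ldots,k\}$ let $p_i=a_i^2+b_i^2$, where $a_i,b_i$ are integers and $a_i$ is even. Then the number $\mathcal{K}_4(G_n)$ of cliques of order four in the Paley-type graph $G_n$ is $$\mathcal{K}_4(G_n)=\frac{1}{3\times 8^{2k+1}}\prod_{i=1}^k\left[p_i^{4\alpha_i-3}(p_i-1)\{(p_i-9)^2-4a_i^2\}\right].$$
   Context: For $n=p_1^{\alpha_1}\cdots p_k^{\alpha_k}$ with distinct primes $p_i\equiv 1\pmod 4$ and $\alpha_i\ge 1$, let $\mathbb{Z}_n^\ast$ be the group of units of the ring $\mathbb{Z}_n=\mathbb{Z}/n\mathbb{Z}$. The Paley-type graph $G_n$ is the simple undirected graph with vertex set $\mathbb{Z}_n$ in which $xy$ is an edge if and only if $x-y\equiv a^2\pmod n$ for some $a\in\mathbb{Z}_n^\ast$ (this is symmetric since $-1$ is a square in $\mathbb{Z}_n^\ast$). For a graph $G$, $\mathcal{K}_m(G)$ denotes the number of cliques of order $m$ in $G$, i.e. the number of $m$-element sets of pairwise adjacent vertices. Every prime $p\equiv 1\pmod 4$ can be written as $p=a^2+b^2$ with $a$ even, and then $a^2$ and $b^2$ are uniquely determined. *)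

(* Defs.v *)
From HB Require Import structures.
From mathcomp Require Import all_boot all_order all_algebra.

Set Implicit Arguments.
Unset Strict Implicit.
Unset Printing Implicit Defensive.

Import Order.TTheory GRing.Theory Num.Theory.

Local Open Scope ring_scope.

(* ['Z_n] is the ring Z/nZ only for [1 < n]; the graph is only meant for
   such n. *)
Definition paley_type_graph (n : nat) : rel 'Z_n :=
  fun x y => [exists a : 'Z_n, (a \is a GRing.unit) && (x - y == a ^+ 2)].

Definition is_clique (T : finType) (e : rel T) (S : {set T}) : bool :=
  [forall x in S, forall y in S, (x != y) ==> e x y].

Definition num_cliques (T : finType) (e : rel T) (m : nat) : nat :=
  #|[set S : {set T} | (#|S| == m) && is_clique e S]|.

(* Main.v *)
(* A clique of order m is the image of m! ordered cliques.  Being a unit square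
   modulo n only depends on the residues modulo the primes dividing n (Chinese
   remainders and Hensel lifting), so ordered cliques are multiplicative in n
   and each factor p^alpha reduces to p.

   Over F_q, with chi the quadratic character, translating and scaling two
   vertices to 0 and 1 reduces the count to sums of chi, all elementary except
     J = sum_{z,w} chi(z) chi(z-1) chi(w) chi(w-1) chi(z-w).
   With phi(r) = sum_x chi(x) chi(x^2+r), one has phi(-1)^2 = 2q + J, Jacobsthal's
   identity gives phi(-1)^2 + phi(s)^2 = 4q for a nonsquare s, and a count modulo
   4 shows that phi(s)/2 is even.  So J = 2q - 4 a^2 where a = phi(s)/2 is the even
   term of a representation of q as a sum of two squares; that representation is
   unique when q is prime. *)
Require Import Defs.
From HB Require Import structures.
From mathcomp Require Import all_boot all_order all_algebra.
From mathcomp Require Import cyclic finfield ring lra zify.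

Set Implicit Arguments.
Unset Strict Implicit.
Unset Printing Implicit Defensive.

Import Order.TTheory GRing.Theory Num.Theory.

Local Open Scope ring_scope.

(** * The quadratic character of a finite field of order 1 modulo 4 *)

Section QuadraticCharacter.
Variable F : finFieldType.

Lemma expf_card_pred (x : F) : x != 0 -> x ^+ #|F|.-1 = 1.
Proof.
move=> x0; apply: (mulfI x0).
by rewrite -exprS prednK ?(ltnW (finNzRing_gt1 F)) // expf_card mulr1.
Qed.

Lemma finField_prim_root : exists z : F, (#|F|.-1).-primitive_root z.
Proof.
have n0 : (0 < #|F|.-1)%N by rewrite -subn1 subn_gt0 finNzRing_gt1.
have /(has_prim_root n0) : all (#|F|.-1).-unity_root (enum (predC1 (0 : F))).
  apply/allP=> x; rewrite mem_enum unity_rootE => /= x0.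
  by rewrite expf_card_pred.
rewrite enum_uniq -cardE cardC1 leqnn => /(_ isT isT) /hasP[z _ pz].
by exists z.
Qed.

Definition qchar (x : F) : int :=
  if x == 0 then 0 else if [exists y, x == y ^+ 2] then 1 else -1.
Local Notation chi := qchar.

Hypothesis q4 : (#|F| = 1 %[mod 4])%N.

(** Since [#|F|.-1] is even, the parity of an exponent of [z] is well defined, and the nonzero
    squares are the even powers. Multiplicativity of [qchar] rests on this. *)
Lemma qchar_prim (z : F) k :
  (#|F|.-1).-primitive_root z -> chi (z ^+ k) = (-1) ^+ k.
Proof.
move=> pz; have q_gt1 : (1 < #|F|)%N := finNzRing_gt1 F; have q4' := q4.
rewrite /qchar expf_eq0 (prim_root_eq0 pz).
have -> : #|F|.-1 == 0%N = false by lia.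
rewrite andbF -signr_odd; case: existsP => [[y /eqP zy]|].
  have y0 : y != 0.
    apply/eqP=> y0; move: zy; rewrite y0 expr0n /= => /eqP.
    by rewrite expf_eq0 (prim_root_eq0 pz) => /andP[_]; lia.
  have [j yj] := prim_rootP pz (expf_card_pred y0).
  move: zy; rewrite yj -exprM => /eqP; rewrite (eq_prim_root_expr pz) => /eqP.
  move=> /(congr1 (modn^~ 2)); rewrite !modn_dvdm ?dvdn2; last first.
  - by lia.
  - by lia.
  by case: odd (modn2 k) => //= ->; rewrite modnMl.
have [//|ek []] := boolP (odd k).
by exists (z ^+ k./2); rewrite -exprM muln2 even_halfK.
Qed.

Lemma qchar0 : chi 0 = 0.
Proof. by rewrite /qchar eqxx. Qed.

Lemma qcharM : {morph chi : x y / x * y}.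
Proof.
move=> x y; have [->|x0] := eqVneq x 0; first by rewrite mul0r !qchar0 mul0r.
have [->|y0] := eqVneq y 0; first by rewrite mulr0 !qchar0 mulr0.
have [z pz] := finField_prim_root.
have [i ->] := prim_rootP pz (expf_card_pred x0).
have [j ->] := prim_rootP pz (expf_card_pred y0).
by rewrite -exprD !(qchar_prim _ pz) exprD.
Qed.

Lemma qchar_sqr x : chi x ^+ 2 = (x != 0)%:R.
Proof. by rewrite /qchar; case: eqP => //=; case: ifP. Qed.

Lemma qchar_of_sqr x : chi (x ^+ 2) = (x != 0)%:R.
Proof. by rewrite expr2 qcharM -expr2 qchar_sqr. Qed.

Lemma qchar_eq0 x : (chi x == 0) = (x == 0).
Proof. rewrite /qchar; case: (x == 0) => //; by case: [exists y, _]. Qed.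

Lemma qchar1 : chi 1 = 1.
Proof. by rewrite -(expr1n F 2) qchar_of_sqr oner_neq0. Qed.

Lemma exists_qcharN1 : exists z, chi z = -1.
Proof. by have [z pz] := finField_prim_root; exists z; rewrite (qchar_prim 1 pz). Qed.

(** For a primitive root [z] of order [m], a multiple of 4, [z ^+ (m %/ 2)] is a square root of 1
    other than 1, hence -1, and [z ^+ (m %/ 4)] squares to it. As -1 differs from 1, the
    characteristic is not 2. *)
Lemma exists_sqrtN1 : (2 != 0 :> F) /\ exists i : F, i ^+ 2 = -1.
Proof.
have [z pz] := finField_prim_root.
have q_gt1 : (1 < #|F|)%N := finNzRing_gt1 F; have q4' := q4.
set m := #|F|.-1 in pz.
have h1 : z ^+ (m %/ 2) != 1 by rewrite -(prim_order_dvd pz) gtnNdvd; lia.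
have h2 : z ^+ (m %/ 2) = -1.
  have /eqP : (z ^+ (m %/ 2)) ^+ 2 = 1.
    by rewrite -exprM divnK ?(prim_expr_order pz) // /m; lia.
  by rewrite sqrf_eq1 (negPf h1) => /eqP.
split; last first.
  by exists (z ^+ (m %/ 4)); rewrite -exprM -h2; congr (_ ^+ _); rewrite /m; lia.
apply: contraNneq h1 => two0; rewrite h2; apply/eqP/esym/eqP.
by rewrite -subr_eq0 opprK -mulr2n two0.
Qed.

Lemma two_neq0 : 2 != 0 :> F.
Proof. by case: exists_sqrtN1. Qed.

Lemma qcharN x : chi (- x) = chi x.
Proof.
rewrite -mulN1r qcharM; have [_ [i iE]] := exists_sqrtN1.
rewrite -iE qchar_of_sqr; case: eqP iE => [->|_ _]; last by rewrite mul1r.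
by rewrite expr0n /= => /esym/eqP; rewrite oppr_eq0 oner_eq0.
Qed.

Lemma qchar_subC x y : chi (x - y) = chi (y - x).
Proof. by rewrite -opprB qcharN. Qed.

Lemma sum_sqrt x : \sum_y (y ^+ 2 == x)%:R = 1 + chi x.
Proof.
have [->|x0] := eqVneq x 0.
  rewrite qchar0 addr0 (bigD1 0) //= expr0n eqxx big1 ?addr0 // => y /negPf y0.
  by rewrite expf_eq0 y0.
rewrite /qchar (negPf x0); case: existsP => [[y /eqP xE]|nex]; last first.
  rewrite subrr big1 // => y _; case: eqP => // yx.
  by case: nex; exists y; rewrite yx.
have y0 : y != 0 by apply: contraNneq x0 => y0; rewrite xE y0 expr0n.
have yN : - y != y.
  by rewrite -subr_eq0 -opprD oppr_eq0 -mulr2n -mulr_natl mulf_neq0 ?two_neq0.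
rewrite (bigD1 y) //= (bigD1 (- y)) //= sqrrN xE eqxx big1 ?addr0 // => w.
by rewrite eqf_sqr => /andP[/negPf-> /negPf->].
Qed.

(** * Fibre counting and elementary character sums *)

Lemma sum_comp_count (I J : finType) (P : pred I) (f : I -> J) (G : J -> int) :
  \sum_(i | P i) G (f i) = \sum_j (\sum_(i | P i) (f i == j)%:R) * G j.
Proof.
rewrite (eq_bigr (fun i => \sum_j (f i == j)%:R * G j)) => [|i _].
  by rewrite exchange_big; apply: eq_bigr => j _; rewrite mulr_suml.
rewrite (bigD1 (f i)) //= eqxx mul1r big1 ?addr0 // => j.
by rewrite eq_sym => /negPf->; rewrite mul0r.
Qed.

Lemma sum_sqr (G : F -> int) : \sum_x G (x ^+ 2) = \sum_x (1 + chi x) * G x.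
Proof. by rewrite sum_comp_count; apply: eq_bigr => x _; rewrite sum_sqrt. Qed.

Lemma sum_translate c (G : F -> int) : \sum_x G (x + c) = \sum_x G x.
Proof. by rewrite [RHS](reindex_inj (addIr c)). Qed.

Lemma sum_scale c (G : F -> int) : c != 0 -> \sum_x G (c * x) = \sum_x G x.
Proof. by move=> c0; rewrite [RHS](reindex_inj (mulfI c0)). Qed.

Lemma sum_qchar : \sum_x chi x = 0.
Proof.
have [z zN] := exists_qcharN1.
have z0 : z != 0 by rewrite -qchar_eq0 zN.
have: \sum_x chi x = - \sum_x chi x.
  rewrite -[LHS](sum_scale _ z0) -sumrN; apply: eq_bigr => x _.
  by rewrite qcharM zN mulN1r.
by lia.
Qed.

Lemma sum_const1 : \sum_(x : F) 1 = #|F|%:R :> int.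
Proof. by rewrite sumr_const. Qed.

Lemma sum_delta c (G : F -> int) : \sum_x (x == c)%:R * G x = G c.
Proof.
rewrite (bigD1 c) //= eqxx mul1r big1 ?addr0 // => x /negPf->.
by rewrite mul0r.
Qed.

(** Once [a] is translated to 0, a term with [x] nonzero is [chi (1 + c / x)]. For [c] nonzero,
    [1 + c / x] takes every value except 1, which leaves [- chi 1]. *)
Lemma sum_qchar_prod a b :
  \sum_x chi (x - a) * chi (x - b) = #|F|%:R * (a == b)%:R - 1.
Proof.
rewrite -(sum_translate a).
rewrite (eq_bigr (fun x => chi x * chi (x + (a - b)))); last first.
  by move=> x _; rewrite addrK addrA.
rewrite -subr_eq0; set c := a - b.
have [c0|c0] := eqVneq c 0.
  rewrite (bigD1 0) //= qchar0 mul0r add0r mulr1.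
  rewrite (eq_bigr (fun => 1)) => [|x x0]; last by rewrite c0 addr0 -expr2 qchar_sqr x0.
  by have := sum_const1; rewrite (bigD1 0) //= => <-; rewrite [1 + _]addrC addrK.
rewrite mulr0 add0r (bigD1 0) //= qchar0 mul0r add0r.
rewrite (eq_bigr (fun x => chi (1 + c * x^-1))); last first.
  (* The factor 1 is rewritten as [chi (x ^+ 2)], and [x ^+ 2 * (1 + c / x) = x * (x + c)]. *)
  move=> x x0; rewrite -qcharM -[RHS]mul1r -[1 in RHS]/((true : nat)%:R) -x0.
  by rewrite -qchar_of_sqr -qcharM; congr chi; field.
(* The convention [0^-1 = 0] makes inversion a bijection of [F]; the term at 0 is then [chi 1],
   split off afterwards. *)
have: \sum_x chi (1 + c * x^-1) = 0.
  rewrite (reindex_inj invr_inj) (eq_bigr (fun x => chi (c * x + 1))).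
    by rewrite (sum_scale (fun y => chi (y + 1)) c0) (sum_translate 1) sum_qchar.
  by move=> x _; rewrite invrK addrC.
rewrite (bigD1 0) //= invr0 mulr0 addr0 qchar1.
by move/eqP; rewrite addrC addr_eq0 => /eqP.
Qed.

Local Notation q := (#|F|%:R : int).

Lemma four_neq0 : 4 != 0 :> F.
Proof. by rewrite (natrM _ 2 2) mulf_neq0 ?two_neq0. Qed.

(** Completing the square: 4 times the quadratic is [(2x - s)^2 - (s^2 - 4v)]. *)
Lemma sum_quadratic s v :
  \sum_x (x ^+ 2 - s * x + v == 0)%:R = 1 + chi (s ^+ 2 - 4 * v).
Proof.
have h2 := two_neq0; have h4 := four_neq0.
rewrite -sum_sqrt -[RHS](sum_translate (- s)) -[RHS](sum_scale _ h2) /=.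
apply: eq_bigr => x _; congr ((nat_of_bool _)%:R).
rewrite -[RHS]subr_eq0 -[LHS](mulrI_eq0 _ (mulfI h4)); congr (_ == 0).
by ring.
Qed.

Lemma sum_add_inv (G : F -> int) :
  \sum_(x | x != 0) G (x + x^-1) = \sum_d (1 + chi (d ^+ 2 - 4)) * G d.
Proof.
rewrite sum_comp_count; apply: eq_bigr => d _; congr (_ * _).
rewrite -[4]mulr1 -sum_quadratic [RHS](bigD1 0) //=.
rewrite expr0n /= mulr0 subr0 add0r oner_eq0 add0r.
apply: eq_bigr => x x0; congr ((nat_of_bool _)%:R).
rewrite -subr_eq0 -[LHS](mulrI_eq0 _ (mulfI x0)); congr (_ == 0).
by field.
Qed.

(** Pairs with sum [s] and product [v] correspond to the roots of [X^2 - s X + v], which the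
    discriminant counts. *)
Lemma sum_add_mul (G : F -> F -> int) :
  \sum_x \sum_y G (x + y) (x * y) =
  \sum_s \sum_v (1 + chi (s ^+ 2 - 4 * v)) * G s v.
Proof.
under eq_bigr => x _ do rewrite -(sum_translate (- x)).
rewrite exchange_big; apply: eq_bigr => s _ /=.
rewrite (eq_bigr (fun x => G s (x * (s - x)))) => [|x _]; last first.
  by congr G; ring.
rewrite sum_comp_count; apply: eq_bigr => v _; congr (_ * _).
rewrite -sum_quadratic; apply: eq_bigr => x _; congr ((nat_of_bool _)%:R).
by rewrite -subr_eq0 -oppr_eq0; congr (_ == 0); ring.
Qed.

(** * Jacobsthal sums and the sum J *)

Definition jacobsthal (r : F) : int := \sum_x chi x * chi (x ^+ 2 + r).
Local Notation phi := jacobsthal.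

(** The sum J. For [z] other than 0 and 1, the sum over [w] without the factors in [z] alone is
    minus the Frobenius trace of the Legendre curve [y^2 = w (w - 1) (w - z)]. *)
Definition legendre_moment : int :=
  \sum_z \sum_w chi z * chi (z - 1) * (chi w * chi (w - 1)) * chi (z - w).

Lemma sum_qchar_affine a b : a != 0 -> \sum_x chi (a * x + b) = 0.
Proof.
move=> a0; rewrite (sum_scale (fun x => chi (x + b)) a0).
by rewrite (sum_translate b) sum_qchar.
Qed.

(** Putting [S = 4 v R] and dividing by the square [v ^+ 2] leaves a dependence on [v] through
    [v + v^-1] only. Then [sum_add_inv] brings in [d ^+ 2 - 4], which becomes [16 T (T - 1)] for
    [d = 4 T - 2]. *)
Lemma legendre_moment_twist :
  \sum_v \sum_S chi v * chi S * chi (S - 4 * v) * chi ((1 + v) ^+ 2 - S) =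
  legendre_moment.
Proof.
have h4 := four_neq0; have h2 := two_neq0.
have chi4 : chi 4 = 1 by rewrite [4](natrM F 2 2) -expr2 qchar_of_sqr h2.
rewrite (bigD1 0) //= big1 ?add0r => [|S _]; last by rewrite qchar0 !mul0r.
transitivity (\sum_(v | v != 0) \sum_R
    chi R * chi (R - 1) * chi ((v + v^-1) + (2 - 4 * R))).
  apply: eq_bigr => v v0; rewrite -(sum_scale _ (mulf_neq0 h4 v0)).
  apply: eq_bigr => R _.
  have cv : chi v * chi v = 1 by rewrite -expr2 qchar_sqr v0.
  have -> : 4 * v * R - 4 * v = 4 * v * (R - 1) by ring.
  have <- : v * ((1 + v) ^+ 2 - 4 * v * R) / v ^+ 2 = (v + v^-1) + (2 - 4 * R).
    by field.
  have cvi : chi (v ^+ 2)^-1 = 1 by rewrite -exprVn qchar_of_sqr invr_eq0 v0.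
  rewrite !qcharM chi4 cvi.
  set a := chi R; set b := chi (R - 1); set c := chi (_ - _).
  rewrite mulr1 !mul1r; transitivity (chi v * chi v * (a * b * (chi v * c))).
    by ring.
  by rewrite cv mul1r.
rewrite exchange_big; apply: eq_bigr => R _ /=.
rewrite -mulr_sumr (sum_add_inv (fun d => chi (d + (2 - 4 * R)))).
rewrite [RHS](eq_bigr (fun w =>
  chi R * chi (R - 1) * (chi w * chi (w - 1) * chi (R - w)))); last first.
  by move=> w _; rewrite !mulrA.
rewrite -mulr_sumr; congr (_ * _).
rewrite (eq_bigr (fun d => chi (1 * d + (2 - 4 * R)) +
    chi (d ^+ 2 - 4) * chi (d + (2 - 4 * R)))) => [|d _]; last first.
  by rewrite mulrDl !mul1r.
rewrite big_split /= sum_qchar_affine ?oner_neq0 // add0r.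
rewrite -(sum_translate (- 2)) -(sum_scale _ h4); apply: eq_bigr => T _ /=.
rewrite (qchar_subC R).
have -> : (4 * T - 2) ^+ 2 - 4 = 4 ^+ 2 * (T * (T - 1)) by ring.
have -> : 4 * T - 2 + (2 - 4 * R) = 4 * (T - R) by ring.
by rewrite !qcharM !chi4 !mul1r.
Qed.

(* Expand the square, pass to the elementary symmetric functions [s], [v] of the
   two variables, using [(x^2 - 1) (y^2 - 1) = (1 + v)^2 - s^2], and then sum
   over [S = s^2]. *)
Lemma jacobsthal_sqr_N1 : phi (-1) ^+ 2 = 2 * q + legendre_moment.
Proof.
have h4 := four_neq0; have h2 := two_neq0.
rewrite expr2 /phi mulr_suml.
transitivity (\sum_x \sum_y (chi (x * y) * chi ((1 + x * y) ^+ 2 - (x + y) ^+ 2))).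
  apply: eq_bigr => x _; rewrite mulr_sumr; apply: eq_bigr => y _.
  rewrite mulrACA -!qcharM; congr chi; ring.
rewrite (sum_add_mul (fun s v => chi v * chi ((1 + v) ^+ 2 - s ^+ 2))).
rewrite exchange_big /= -legendre_moment_twist.
have chiq c : \sum_v chi v * (q * (v == c)%:R - 1) = q * chi c.
  rewrite (eq_bigr (fun v => q * ((v == c)%:R * chi v) - chi v)) => [|v _].
    by rewrite big_split /= -mulr_sumr sum_delta sumrN sum_qchar subr0.
  by ring.
(* The two terms in [q] come from the degenerate quadratics: [s ^+ 2 = (1 + v) ^+ 2] has a double
   root at [v = -1], and [4 v = (1 + v) ^+ 2] holds at [v = 1]. *)
have -> : 2 * q = q * chi (-1) + q * chi 1 by rewrite qcharN qchar1; ring.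
rewrite -!chiq -!big_split; apply: eq_bigr => v _ /=.
pose H S := chi (S - 4 * v) * chi ((1 + v) ^+ 2 - S).
rewrite (eq_bigr (fun s =>
  chi v * chi ((1 + v) ^+ 2 - s ^+ 2) + chi v * H (s ^+ 2))) => [|s _].
  rewrite big_split /= -!mulr_sumr sum_sqr.
  rewrite [X in _ + _ * X](eq_bigr (fun S => H S + chi S * H S)) => [|S _]; last first.
    by rewrite mulrDl mul1r.
  rewrite big_split /= mulrDr addrA; congr (_ + _ + _).
  - congr (_ * _).
    rewrite (eq_bigr (fun s => chi (s - (1 + v)) * chi (s - - (1 + v)))) => [|s _].
      rewrite sum_qchar_prod; congr (_ * (nat_of_bool _)%:R - _).
      rewrite -subr_eq0 -[RHS]subr_eq0 -[RHS](mulrI_eq0 _ (mulfI h2)).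
      by congr (_ == 0); ring.
    by rewrite -qcharM -qcharN; congr chi; ring.
  - congr (_ * _).
    rewrite (eq_bigr (fun S => chi (S - 4 * v) * chi (S - (1 + v) ^+ 2))) => [|S _].
      rewrite sum_qchar_prod; congr (_ * (nat_of_bool _)%:R - _).
      rewrite -subr_eq0 -[RHS]subr_eq0 -[RHS](expf_eq0 _ 2) -oppr_eq0.
      by congr (_ == 0); ring.
    by rewrite /H [in LHS](qchar_subC (_ ^+ 2)).
  - by rewrite mulr_sumr; apply: eq_bigr => S _; rewrite /H !mulrA.
by rewrite /H; ring.
Qed.

Lemma jacobsthal0 : phi 0 = 0.
Proof.
rewrite -[RHS]sum_qchar; apply: eq_bigr => x _.
rewrite addr0 qchar_of_sqr; case: eqP => [->|_]; last by rewrite mulr1.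
by rewrite qchar0 mul0r.
Qed.

Lemma jacobsthal_scale t r : t != 0 -> phi (t ^+ 2 * r) = chi t * phi r.
Proof.
move=> t0; rewrite /phi -(sum_scale _ t0) mulr_sumr; apply: eq_bigr => x _ /=.
rewrite exprMn -mulrDr (qcharM t) (qcharM (t ^+ 2)) qchar_of_sqr t0 mul1r; ring.
Qed.

Lemma qchar_values x : x != 0 -> chi x = 1 \/ chi x = -1.
Proof. by rewrite /qchar => /negPf->; case: ifP; [left | right]. Qed.

Lemma qchar1_sqr x : chi x = 1 -> exists2 y, y != 0 & x = y ^+ 2.
Proof.
rewrite /qchar; case: eqP => // x0; case: existsP => // -[y /eqP xE] _.
by exists y => //; apply/eqP=> y0; case: x0; rewrite xE y0 expr0n.
Qed.

(** Rescaling by [t ^+ 2] multiplies [phi] by the sign [chi t], which squaring removes. *)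
Lemma jacobsthal_sqr_class r s : chi r = chi s -> phi r ^+ 2 = phi s ^+ 2.
Proof.
move=> rs; have [s0|s0] := eqVneq s 0.
  by move: rs => /eqP; rewrite s0 qchar0 qchar_eq0 => /eqP->.
have : chi (r / s) = 1.
  have : chi (r / s) * chi s = chi s by rewrite -qcharM divfK.
  by case: (qchar_values s0) => ->; lia.
case/qchar1_sqr => t t0 rE; have {}rE : r = t ^+ 2 * s by rewrite -rE divfK.
by rewrite rE jacobsthal_scale // exprMn qchar_sqr t0 mul1r.
Qed.

(** Expand the square and sum over [r] first: [sum_qchar_prod] leaves [q] times the pairs with
    [y = x] or [y = - x], while its -1 terms cancel in the sum over [y]. *)
Lemma sum_jacobsthal_sqr : \sum_r phi r ^+ 2 = 2 * q * (q - 1).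
Proof.
rewrite (eq_bigr (fun r => \sum_x \sum_y
    chi (x * y) * (chi (r - - x ^+ 2) * chi (r - - y ^+ 2)))); last first.
  move=> r _; rewrite expr2 /phi mulr_suml; apply: eq_bigr => x _.
  rewrite mulr_sumr; apply: eq_bigr => y _.
  by rewrite mulrACA (qcharM x) !opprK ![r + _]addrC.
rewrite exchange_big (eq_bigr (fun x => 2 * q * (x != 0)%:R)) => [|x _] /=.
  rewrite -mulr_sumr; congr (_ * _); rewrite -sum_const1 (bigD1 0) //=.
  rewrite eqxx add0r [in RHS](bigD1 0) //= addrAC subrr add0r.
  by apply: eq_bigr => x ->.
rewrite exchange_big /=.
rewrite (eq_bigr (fun y => q * (chi (x * y) * (y ^+ 2 == x ^+ 2)%:R) - chi (x * y + 0))).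
  rewrite big_split sumrN -mulr_sumr /=; have [->|x0] := eqVneq x 0.
    rewrite !big1 ?mulr0 ?subr0 // => y _; first by rewrite mul0r addr0 qchar0.
    by rewrite mul0r qchar0 mul0r.
  rewrite sum_qchar_affine // subr0 (eq_bigr (fun y => (y ^+ 2 == x ^+ 2)%:R)).
    by rewrite sum_sqrt qchar_of_sqr x0 /=; ring.
  move=> y _; case: eqP => [|_]; last by rewrite mulr0.
  move/eqP; rewrite eqf_sqr => /orP[] /eqP->; rewrite mulr1 ?mulrN ?qcharN.
    by rewrite -expr2 qchar_of_sqr x0.
  by rewrite -expr2 qchar_of_sqr x0.
move=> y _; rewrite -mulr_sumr sum_qchar_prod addr0 eqr_opp [x ^+ 2 == _]eq_sym.
by ring.
Qed.

Lemma jacobsthal_sum_of_squares n : chi n = -1 ->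
  phi (-1) ^+ 2 + phi n ^+ 2 = 4 * q.
Proof.
move=> nE; set A : int := phi (-1) ^+ 2; set B : int := phi n ^+ 2.
(* The values [A] on nonzero squares and [B] on nonsquares are interpolated linearly in [chi r],
   whose sum vanishes. *)
have step r : 2 * phi r ^+ 2 = (1 - (r == 0)%:R) * (A + B) + (A - B) * chi r.
  have [->|r0] := eqVneq r 0; first by rewrite jacobsthal0 qchar0 /=; ring.
  have [rE|rE] := qchar_values r0; rewrite rE /=.
    by rewrite (@jacobsthal_sqr_class r (-1)) ?qcharN ?qchar1 // -/A; ring.
  by rewrite (@jacobsthal_sqr_class r n) ?nE // -/B; ring.
have : 2 * \sum_r phi r ^+ 2 = (q - 1) * (A + B).
  rewrite mulr_sumr (eq_bigr _ (fun r _ => step r)) big_split /= -mulr_sumr sum_qchar.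
  rewrite mulr0 addr0 -mulr_suml; congr (_ * _).
  rewrite big_split /= sum_const1 sumrN; congr (_ - _).
  by rewrite -[RHS](sum_delta 0 (fun=> 1)); apply: eq_bigr => x _; rewrite mulr1.
rewrite sum_jacobsthal_sqr => h.
have q1 : q - 1 != 0.
  by rewrite subr_eq0 pnatr_eq1 neq_ltn (finNzRing_gt1 F) orbT.
by apply: (mulfI q1); rewrite -h; ring.
Qed.

(** Nonzero elements pair off under negation, the characteristic not being 2; [enum_rank] selects
    one element of each pair. *)
Lemma sum_symmetric_even (g : F -> int) :
  g 0 = 0 -> (forall x, g (- x) = g x) -> exists m, \sum_x g x = 2 * m.
Proof.
move=> g0 gN; pose P (x : F) := (enum_rank x < enum_rank (- x)%R)%N.
exists (\sum_(x | P x) g x).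
rewrite (bigID P) /= [X in _ + X](bigD1 0) /=; last by rewrite /P oppr0 ltnn.
rewrite g0 add0r [X in _ + X](reindex_inj oppr_inj) /= mulr_natl mulr2n; congr (_ + _).
apply: eq_big => [x|x _]; last by rewrite gN.
rewrite /P opprK oppr_eq0 -leqNgt leq_eqVlt.
have [->|x0] := eqVneq x 0; first by rewrite oppr0 ltnn andbF.
rewrite andbT; case: eqP => //= /ord_inj/enum_rank_inj/eqP.
rewrite -subr_eq0 opprK -mulr2n -mulr_natl mulf_eq0 (negPf x0).
by rewrite (negPf two_neq0).
Qed.

(** A summand [f x] is 0, 1 or -1, so it equals [f x ^+ 2 - 2 * (f x == -1)]. The squares count the
    nonzeros of [f], and since [f (- x) = f x] the value -1 is taken an even number of times. *)
Lemma jacobsthal_mod4 r : r != 0 -> exists m, phi r = q - 2 - chi r - 4 * m.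
Proof.
move=> r0; pose f x := chi x * chi (x ^+ 2 + r).
have f3 x : f x = 0 \/ f x = 1 \/ f x = -1.
  rewrite /f -qcharM; case: (eqVneq (x * (x ^+ 2 + r)) 0) => [->|/qchar_values].
    by left; rewrite qchar0.
  by right.
have [||m mE] := @sum_symmetric_even (fun x => (f x == -1)%:R).
- by rewrite /f qchar0 mul0r.
- by move=> x; rewrite /f sqrrN qcharN.
exists m; rewrite /phi (eq_bigr (fun x => f x ^+ 2 - 2 * (f x == -1)%:R)); last first.
  by move=> x _; rewrite -/(f x); case: (f3 x) => [->|[]->].
rewrite big_split sumrN -mulr_sumr mE /=.
rewrite (eq_bigr (fun x => 1 - (x == 0)%:R * 1 - (x ^+ 2 == - r)%:R)); last first.
  move=> x _; rewrite exprMn !qchar_sqr addr_eq0.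
  have [->|x0] := eqVneq x 0; last by case: (_ == _).
  by rewrite expr0n -eqr_oppLR oppr0 eq_sym (negPf r0).
rewrite !big_split /= !sumrN sum_sqrt (sum_delta 0 (fun=> 1)) sum_const1 qcharN.
ring.
Qed.

Lemma legendre_moment_eval : exists c d : int,
  q = (2 * c) ^+ 2 + d ^+ 2 /\ legendre_moment = 2 * q - 4 * (2 * c) ^+ 2.
Proof.
have [n nE] := exists_qcharN1.
have n0 : n != 0 by rewrite -qchar_eq0 nE.
have [m mE] := jacobsthal_mod4 n0.
have N10 : (-1 : F) != 0 by rewrite oppr_eq0 oner_neq0.
have [m' m'E] := jacobsthal_mod4 N10.
have [t tE] : exists t : int, q = 4 * t + 1.
  exists (#|F| %/ 4)%N%:Z; have := q4; set x := #|F|; rewrite natz; lia.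
have := jacobsthal_sum_of_squares nE; have := jacobsthal_sqr_N1.
rewrite mE m'E nE qcharN qchar1 => h1 h2.
(* These are [phi n / 4] and [phi (-1) / 2], computed with [q = 4 t + 1]. *)
exists (t - m), (2 * t - 1 - 2 * m'); by split; move: h1 h2; rewrite tE; lra.
Qed.

(** * Counting ordered four-cliques over the field *)

Definition sqind (x : F) : int := (chi x == 1)%:R.

Lemma sqindE x : 2 * sqind x = 1 + chi x - (x == 0)%:R.
Proof.
rewrite /sqind; have [->|x0] := eqVneq x 0; first by rewrite qchar0.
by case: (qchar_values x0) => ->.
Qed.

Lemma sqindN x : sqind (- x) = sqind x.
Proof. by rewrite /sqind qcharN. Qed.

Lemma sqindMl y x : chi y = 1 -> sqind (y * x) = sqind x.
Proof. by move=> y1; rewrite /sqind qcharM y1 mul1r. Qed.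

Lemma sum_sqind : 2 * \sum_x sqind x = q - 1.
Proof.
rewrite mulr_sumr (eq_bigr _ (fun x _ => sqindE x)) !big_split /= sumrN.
rewrite sum_const1 sum_qchar addr0; congr (_ - _).
by rewrite -[RHS](sum_delta 0 (fun=> 1)); apply: eq_bigr => x _; rewrite mulr1.
Qed.

(** The vertices in question are 0 and 1, to which an edge is normalized. *)
Definition common_nbr (z : F) : int := sqind z * sqind (1 - z).
Local Notation D := common_nbr.
Let u (z : F) : int := (1 + chi z) * (1 + chi (z - 1)).

Lemma common_nbrE z : 4 * D z = u z - 2 * (z == 0)%:R - 2 * (z == 1)%:R.
Proof.
have -> : 4 * D z = (2 * sqind z) * (2 * sqind (1 - z)) by rewrite /D; ring.
rewrite !sqindE /u (qchar_subC 1) subr_eq0 [1 == z]eq_sym.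
have [->|z0] := eqVneq z 0; last have [->|z1] := eqVneq z 1.
- by rewrite qchar0 sub0r qcharN qchar1 eq_sym oner_eq0 /=; ring.
- by rewrite subrr qchar0 qchar1 /=; ring.
by rewrite /=; ring.
Qed.

Lemma sum_u : \sum_z u z = q - 1.
Proof.
rewrite (eq_bigr (fun z => 1 + chi z + chi (1 * z + - 1) + chi (z - 0) * chi (z - 1))).
  rewrite !big_split /= sum_const1 sum_qchar sum_qchar_affine ?oner_neq0 //.
  by rewrite sum_qchar_prod eq_sym oner_eq0 /=; ring.
by move=> z _; rewrite /u mul1r subr0; ring.
Qed.

Lemma sum_common_nbr : 4 * \sum_z D z = q - 5.
Proof.
rewrite mulr_sumr (eq_bigr _ (fun z _ => common_nbrE z)) !big_split /= !sumrN.
rewrite sum_u -!mulr_sumr.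
have d1 c : \sum_(z : F) (z == c)%:R = 1 :> int.
  by rewrite -[RHS](sum_delta c (fun=> 1)); apply: eq_bigr => x _; rewrite mulr1.
by rewrite !d1; ring.
Qed.

Let L (z : F) : int := \sum_w chi w * chi (w - 1) * chi (z - w).

Lemma sum_u_qchar z :
  \sum_w u w * chi (z - w) = q * (z == 0)%:R + q * (z == 1)%:R - 2 + L z.
Proof.
rewrite (eq_bigr (fun w => chi (1 * w + - z) + chi (w - 0) * chi (w - z) +
   chi (w - 1) * chi (w - z) + chi w * chi (w - 1) * chi (z - w))).
  rewrite !big_split /= sum_qchar_affine ?oner_neq0 // !sum_qchar_prod -/(L z).
  by rewrite ![_ == z]eq_sym; ring.
by move=> w _; rewrite /u mul1r subr0 (qchar_subC w z); ring.
Qed.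

(** Exchanging the sums moves [u] inside, where [sum_u_qchar] evaluates it; the term [L w] this
    returns reassembles J. *)
Lemma sum_u_L : \sum_z u z * L z = 2 + legendre_moment.
Proof.
transitivity (\sum_w chi w * chi (w - 1) * \sum_z u z * chi (w - z)).
  rewrite (eq_bigr (fun z => \sum_w chi w * chi (w - 1) * (u z * chi (w - z)))).
    by rewrite exchange_big; apply: eq_bigr => w _; rewrite mulr_sumr.
  move=> z _; rewrite mulr_sumr; apply: eq_bigr => w _.
  by rewrite (qchar_subC w z); ring.
rewrite (eq_bigr (fun w => q * ((w == 0)%:R * (chi w * chi (w - 1))) +
    q * ((w == 1)%:R * (chi w * chi (w - 1))) - 2 * (chi (w - 0) * chi (w - 1)) +
    chi w * chi (w - 1) * L w)) => [|w _].
  rewrite !big_split /= sumrN -!mulr_sumr !sum_delta sum_qchar_prod.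
  rewrite eq_sym oner_eq0 subrr qchar0 /=.
  rewrite (_ : \sum_i _ = legendre_moment); first by ring.
  apply: eq_bigr => w _; rewrite mulr_sumr; apply: eq_bigr => z _.
  by rewrite !mulrA.
by rewrite sum_u_qchar subr0; ring.
Qed.

Let L0 : L 0 = -1.
Proof.
rewrite /L (bigD1 0) //= qchar0 !mul0r add0r.
rewrite (eq_bigr (fun w => chi (1 * w + - 1))) => [|w w0].
  have := sum_qchar_affine (-1) (oner_neq0 F).
  rewrite (bigD1 0) //= mulr0 add0r qcharN qchar1 addrC => /eqP.
  by rewrite addr_eq0 => /eqP.
by rewrite sub0r qcharN mulrAC -expr2 qchar_sqr w0 !mul1r.
Qed.

Let L1 : L 1 = -1.
Proof.
rewrite /L (bigD1 1) //= subrr qchar0 !mulr0 add0r.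
rewrite (eq_bigr (fun w => chi (1 * w + 0))) => [|w w1].
  have := sum_qchar_affine 0 (oner_neq0 F).
  rewrite (bigD1 1) //= mulr1 addr0 qchar1 addrC => /eqP.
  by rewrite addr_eq0 => /eqP.
by rewrite (qchar_subC 1) -mulrA -expr2 qchar_sqr subr_eq0 w1 mulr1 mul1r addr0.
Qed.

Lemma sum_common_nbr_qchar :
  16 * \sum_z D z * \sum_w D w * chi (z - w) = legendre_moment - 6 * q + 36.
Proof.
have inner z : 4 * \sum_w D w * chi (z - w) =
    q * (z == 0)%:R + q * (z == 1)%:R - 2 + L z - 2 * chi z - 2 * chi (z - 1).
  rewrite -sum_u_qchar mulr_sumr.
  rewrite (eq_bigr (fun w => u w * chi (z - w) - 2 * ((w == 0)%:R * chi (z - w)) -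
     2 * ((w == 1)%:R * chi (z - w)))) => [|w _].
    by rewrite !big_split /= !sumrN -!mulr_sumr !sum_delta subr0.
  by rewrite mulrA common_nbrE; ring.
(* [h z] is four times the inner sum, so 16 clears the factor 4 of both occurrences of [D]. *)
pose h z := q * (z == 0)%:R + q * (z == 1)%:R - 2 + L z - 2 * chi z - 2 * chi (z - 1).
have -> : 16 * \sum_z D z * \sum_w D w * chi (z - w) =
    \sum_z u z * h z - 2 * h 0 - 2 * h 1.
  rewrite mulr_sumr (eq_bigr (fun z => u z * h z - 2 * ((z == 0)%:R * h z) -
     2 * ((z == 1)%:R * h z))) => [|z _].
    by rewrite !big_split /= !sumrN -!mulr_sumr !sum_delta.
  rewrite (_ : 16 * (D z * _) = (4 * D z) * (4 * \sum_w D w * chi (z - w))).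
    by rewrite inner -/(h z) common_nbrE; ring.
  by ring.
have u0 : u 0 = 2 by rewrite /u qchar0 sub0r qcharN qchar1.
have u1 : u 1 = 2 by rewrite /u subrr qchar0 qchar1.
have h0 : h 0 = q - 5.
  by rewrite /h L0 eqxx [0 == 1]eq_sym oner_eq0 sub0r qchar0 qcharN qchar1 /=; ring.
have h1 : h 1 = q - 5.
  by rewrite /h L1 eqxx oner_eq0 subrr qchar0 qchar1 /=; ring.
have -> : \sum_z u z * h z = legendre_moment - 2 * q + 16.
  rewrite (eq_bigr (fun z => q * ((z == 0)%:R * u z) + q * ((z == 1)%:R * u z) -
      2 * u z + u z * L z - 2 * (u z * chi (0 - z)) - 2 * (u z * chi (1 - z)))).
    rewrite !big_split /= !sumrN -!mulr_sumr !sum_delta sum_u sum_u_L !sum_u_qchar.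
    by rewrite u0 u1 L0 L1 !eqxx [0 == 1]eq_sym oner_eq0 /=; ring.
  by move=> z _; rewrite /h sub0r qcharN (qchar_subC 1); ring.
by rewrite h0 h1; ring.
Qed.

(** Edges are counted as ordered pairs, hence twice each. *)
Definition common_nbr_edges : int :=
  \sum_z \sum_w D z * D w * sqind (z - w).

(** [sqindE] splits the edge indicator into a constant, a character and a diagonal part; as [D] is
    idempotent, the diagonal contributes minus the sum of [D]. *)
Lemma common_nbr_edgesE :
  32 * common_nbr_edges = (q - 9) ^+ 2 - (2 * q - legendre_moment).
Proof.
have DD z : D z * D z = D z.
  by rewrite /D /sqind; case: (_ == 1); case: (_ == 1).
have : 2 * common_nbr_edges =
   (\sum_z D z) * (\sum_w D w) + \sum_z D z * (\sum_w D w * chi (z - w)) - \sum_z D z.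
  rewrite mulr_suml -big_split /= -sumrB mulr_sumr; apply: eq_bigr => z _.
  rewrite -mulrDr -[X in _ - X]DD -mulrBr -big_split /=.
  rewrite -[X in _ * (_ - X)](sum_delta z) -sumrB !mulr_sumr; apply: eq_bigr => w _.
  rewrite mulrCA sqindE subr_eq0 [z == w]eq_sym; ring.
have := sum_common_nbr_qchar; have := sum_common_nbr.
set d := \sum_z D z; set E := \sum_z _; set J := legendre_moment => hd hE hM.
rewrite (_ : 32 * _ = 16 * (2 * common_nbr_edges)); last by ring.
rewrite hM (_ : 16 * _ = (4 * d) ^+ 2 + 16 * E - 4 * (4 * d)); last by ring.
by rewrite hd hE; ring.
Qed.

Definition sqind4 : int :=
  \sum_x \sum_y \sum_z \sum_w
    (sqind (x - y) * sqind (x - z) * sqind (x - w) * sqind (y - z) *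
     sqind (y - w) * sqind (z - w)).

(** Translating [x] to 0 gives the factor [q]; scaling by the nonzero square [y] preserves [sqind]
    and moves [y] to 1, giving the factor [(q - 1) / 2]. *)
Lemma sqind4E : 2 * sqind4 = q * (q - 1) * common_nbr_edges.
Proof.
have -> : sqind4 = q * (\sum_y sqind y * common_nbr_edges).
  rewrite -sum_const1 mulr_suml; apply: eq_bigr => x _; rewrite mul1r.
  rewrite -(sum_translate x); apply: eq_bigr => y _ /=.
  rewrite opprD addrCA subrr addr0 sqindN.
  have [y1|y1] := eqVneq (chi y) 1; last first.
    have -> : sqind y = 0 by rewrite /sqind (negPf y1).
    by rewrite mul0r big1 // => z _; rewrite big1 // => w _; rewrite !mul0r.
  have y0 : y != 0 by rewrite -qchar_eq0 y1.
  rewrite [in RHS]/sqind y1 mul1r -(sum_translate x) -(sum_scale _ y0).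
  apply: eq_bigr => z _ /=.
  rewrite -(sum_translate x) -(sum_scale _ y0); apply: eq_bigr => w _ /=.
  have e c : x - (y * c + x) = - (y * c) by ring.
  have e1 c : y + x - (y * c + x) = y * (1 - c) by ring.
  have e2 : y * z + x - (y * w + x) = y * (z - w) by ring.
  rewrite !e !e1 e2 !sqindN !sqindMl // (_ : sqind y = 1); last by rewrite /sqind y1.
  by rewrite /D; ring.
by rewrite -mulr_suml -sum_sqind; ring.
Qed.

End QuadraticCharacter.

(** * Ordered cliques: passage to cliques, fibres and products *)

Definition ordered_cliques (T : finType) (e : rel T) m : {set {ffun 'I_m -> T}} :=
  [set f : {ffun 'I_m -> T} | [forall i, forall j, (i != j) ==> e (f i) (f j)]].

Lemma ordered_cliquesP (T : finType) (e : rel T) m (f : {ffun 'I_m -> T}) :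
  reflect (forall i j, i != j -> e (f i) (f j)) (f \in ordered_cliques e m).
Proof.
rewrite inE; apply: (iffP 'forall_forallP) => h i j; last exact/implyP/h.
exact: implyP (h i j).
Qed.

(** Irreflexivity makes ordered cliques injective, so those with image a given clique [S] are
    exactly the injections of ['I_m] into [S]. *)
Lemma card_ordered_cliques (T : finType) (e : rel T) m :
  irreflexive e -> #|ordered_cliques e m| = (num_cliques e m * m`!)%N.
Proof.
move=> eI; rewrite /num_cliques; set C := [set S : {set T} | _].
pose im (f : {ffun 'I_m -> T}) := [set f i | i : 'I_m].
have inj f : f \in ordered_cliques e m -> injective f.
  move=> /ordered_cliquesP fP i j fij; apply/eqP/negPn/negP=> /fP.
  by rewrite fij eI.
have imC f : f \in ordered_cliques e m -> im f \in C.
  move=> fC; rewrite inE card_imset ?card_ord ?eqxx /=; last exact: inj.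
  apply/forall_inP=> _ /imsetP[i _ ->]; apply/forall_inP=> _ /imsetP[j _ ->].
  apply/implyP=> fij; apply: (elimT (ordered_cliquesP _ _) fC).
  by apply: contraNneq fij => ->.
rewrite -sum1_card (partition_big im (mem C)) //= -sum_nat_const.
apply: eq_bigr => S; rewrite inE => /andP[/eqP cS /forall_inP clS].
rewrite sum1_card -[RHS](ffactnn m) -[in X in X ^_ _]cS -[in X in _ ^_ X](card_ord m).
rewrite -card_inj_ffuns_on; apply: eq_card => f; rewrite [RHS]inE [LHS]unfold_in /=.
apply/andP/andP=> [[fC /eqP <-]|[/ffun_onP fS /injectiveP fI]].
  split; last by apply/injectiveP; apply: inj.
  by apply/ffun_onP=> i; apply: imset_f.
split.
  apply/ordered_cliquesP=> i j ij.
  by apply: (implyP (forall_inP (clS _ (fS i)) _ (fS j))); rewrite (inj_eq fI).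
rewrite eqEcard card_imset // card_ord cS leqnn andbT.
by apply/subsetP=> _ /imsetP[i _ ->].
Qed.

Lemma card_ordered_cliques4 (T : finType) (e : rel T) : symmetric e ->
  #|ordered_cliques e 4| =
  (\sum_x \sum_y \sum_z \sum_w
     [&& e x y, e x z, e x w, e y z, e y w & e z w])%N.
Proof.
move=> eS.
pose g (t : T * (T * (T * T))) : {ffun 'I_4 -> T} :=
  [ffun i : 'I_4 => tnth [tuple t.1; t.2.1; t.2.2.1; t.2.2.2] i].
pose i0 : 'I_4 := inord 0; pose i1 : 'I_4 := inord 1.
pose i2 : 'I_4 := inord 2; pose i3 : 'I_4 := inord 3.
pose g' (f : {ffun 'I_4 -> T}) := (f i0, (f i1, (f i2, f i3))).
have ge t : [/\ g t i0 = t.1, g t i1 = t.2.1, g t i2 = t.2.2.1 & g t i3 = t.2.2.2].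
  by rewrite !ffunE !(tnth_nth t.1) !inordK.
have i4 (i : 'I_4) : [\/ i = i0, i = i1, i = i2 | i = i3].
  case: i => -[|[|[|[|//]]]] h; [apply: Or41|apply: Or42|apply: Or43|apply: Or44];
  by apply: val_inj; rewrite /= inordK.
have gK : cancel g g'.
  by move=> t; rewrite /g'; case: (ge t) => -> -> -> ->; case: t => ? [? []].
have g'K : cancel g' g.
  move=> f; apply/ffunP=> i; case: (ge (g' f)) => h0 h1 h2 h3.
  by case: (i4 i) => ->; rewrite ?h0 ?h1 ?h2 ?h3.
under eq_bigr => x _ do (under eq_bigr => y _ do rewrite pair_bigA; rewrite pair_bigA).
rewrite pair_bigA /= -sum1_card big_mkcond /= (reindex g); last first.
  by apply: onW_bij; exists g'.
apply: eq_bigr => -[x [y [z w]]] _ /=; case: (ge (x, (y, (z, w)))) => /= h0 h1 h2 h3.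
set G := g _ in h0 h1 h2 h3 *.
have -> : (G \in ordered_cliques e 4) = [&& e x y, e x z, e x w, e y z, e y w & e z w].
  apply/ordered_cliquesP/idP => [h|/and5P[xy xz xw yz /andP[yw zw]] i j].
    rewrite -h0 -h1 -h2 -h3; do !(apply/andP; split); apply: h;
    by rewrite -val_eqE /= !inordK.
  by case: (i4 i) => ->; case: (i4 j) => ->; rewrite ?eqxx ?h0 ?h1 ?h2 ?h3 // eS.
by case: ifP.
Qed.

(** Adjacency is pulled back along [pi], so the [m] vertices lift independently, each in [c]
    ways. *)
Lemma card_ordered_cliques_fiber (A B : finType) (eA : rel A) (eB : rel B)
    (pi : A -> B) c m :
  (forall b, #|[pred a | pi a == b]| = c) ->
  (forall x y, eA x y = eB (pi x) (pi y)) ->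
  #|ordered_cliques eA m| = (c ^ m * #|ordered_cliques eB m|)%N.
Proof.
move=> cpi epi; pose pif (f : {ffun 'I_m -> A}) := [ffun i => pi (f i)].
have mem_pif f : (f \in ordered_cliques eA m) = (pif f \in ordered_cliques eB m).
  by apply/ordered_cliquesP/ordered_cliquesP => h i j /h; rewrite !ffunE epi.
rewrite -sum1_card (partition_big pif (mem (ordered_cliques eB m))) /=; last first.
  by move=> f; rewrite mem_pif.
rewrite mulnC -sum_nat_const; apply: eq_bigr => g gB; rewrite sum1_card.
transitivity #|family (fun i : 'I_m => [pred a | pi a == g i])|.
  apply: eq_card => f; rewrite unfold_in /= mem_pif; apply/andP/familyP.
    by move=> [_ /eqP <-] i; rewrite inE /pif ffunE.
  move=> h; suff -> : pif f = g by [].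
  by apply/ffunP=> i; rewrite ffunE; apply/eqP; have := h i; rewrite inE.
rewrite card_family foldrE big_map (eq_bigr (fun=> c)) => [|i _]; last exact: cpi.
by rewrite big_enum prod_nat_const card_ord.
Qed.

Lemma card_ordered_cliques_prod (A B : finType) (eA : rel A) (eB : rel B) m :
  #|ordered_cliques (fun x y : A * B => eA x.1 y.1 && eB x.2 y.2) m| =
  (#|ordered_cliques eA m| * #|ordered_cliques eB m|)%N.
Proof.
pose h (fg : {ffun 'I_m -> A} * {ffun 'I_m -> B}) := [ffun i => (fg.1 i, fg.2 i)].
have h_inj : injective h.
  move=> [f g] [f' g'] /ffunP fg; congr (_, _); apply/ffunP=> i;
  by have := fg i; rewrite !ffunE => -[].
rewrite -cardsX -(card_imset _ h_inj); apply: eq_card => f.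
apply/ordered_cliquesP/imsetP => [fP|[[g g'] /setXP[/= gC g'C] ->]].
  exists ([ffun i => (f i).1], [ffun i => (f i).2]).
    by apply/setXP; split; apply/ordered_cliquesP => i j /fP /andP[]; rewrite !ffunE.
  by apply/ffunP=> i; rewrite !ffunE /=; case: (f i).
move: gC g'C => /ordered_cliquesP gP /ordered_cliquesP g'P i j ij.
by rewrite !ffunE /= gP // g'P.
Qed.

(** * Unit squares modulo n: Chinese remainders and Hensel lifting *)

Section UnitSquareDifferences.
Local Open Scope nat_scope.

(** Phrased additively on natural representatives, so that moduli can be compared without changing
    types and no truncated subtraction occurs. *)
Definition unit_square_diff (n x y : nat) : bool :=
  [exists c : 'I_n, coprime n c && (x == y + c ^ 2 %[mod n])].

Lemma unit_square_diffP n x y : 0 < n ->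
  reflect (exists2 c, coprime n c & x = y + c ^ 2 %[mod n]) (unit_square_diff n x y).
Proof.
move=> n0; apply: (iffP existsP) => [[c /andP[nc /eqP xy]]|[c nc xy]]; first by exists c.
exists (Ordinal (ltn_pmod c n0)); rewrite /= coprime_modr nc /=.
by rewrite xy -modnDmr -modnXm modnDmr.
Qed.

Lemma unit_square_diff_mod n x y :
  unit_square_diff n (x %% n) (y %% n) = unit_square_diff n x y.
Proof. by apply: eq_existsb => c; rewrite modn_mod modnDml. Qed.

Lemma unit_square_diff_mul m n x y : 0 < m -> 0 < n -> coprime m n ->
  unit_square_diff (m * n) x y = unit_square_diff m x y && unit_square_diff n x y.
Proof.
move=> m0 n0 mn; have mn0 : 0 < m * n by rewrite muln_gt0 m0.
apply/(unit_square_diffP _ _ mn0)/andP => [[c]|].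
  rewrite coprimeMl => /andP[mc nc] /eqP.
  rewrite chinese_remainder // => /andP[/eqP xm /eqP xn].
  by split; apply/unit_square_diffP => //; exists c.
case=> /(unit_square_diffP _ _ m0)[c mc xm] /(unit_square_diffP _ _ n0)[d nd xn].
exists (chinese m n c d).
  by rewrite coprimeMl -coprime_modr chinese_modl // coprime_modr mc
     -coprime_modr chinese_modr // coprime_modr.
have sqE k e e' : e = e' %[mod k] -> y + e ^ 2 = y + e' ^ 2 %[mod k].
  by move=> E; rewrite -modnDmr -modnXm E modnXm modnDmr.
apply/eqP; rewrite chinese_remainder //; apply/andP; split; apply/eqP.
  by rewrite xm; apply/sqE/esym/chinese_modl.
by rewrite xn; apply/sqE/esym/chinese_modr.
Qed.

Lemma exists_modn_inv a b p : coprime a p -> 0 < a -> exists t, a * t = b %[mod p].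
Proof.
move=> ap a0; have [u v uv _] := egcdnP p a0.
exists (u * b); rewrite mulnA [a * u]mulnC uv (eqP ap) mulnDl mul1n.
by rewrite mulnAC modnMDl.
Qed.

(** A root [c] is corrected to [c + t * p ^ a]: the error [k * p ^ a] disappears modulo [p ^ a.+1]
    once [2 * c * t = k] modulo [p], solvable because [p] divides neither 2 nor [c]. *)
Lemma hensel_step p a x y : prime p -> odd p -> 0 < a ->
  unit_square_diff (p ^ a) x y -> unit_square_diff (p ^ a.+1) x y.
Proof.
move=> pp p2 a0; have p0 := prime_gt0 pp.
have pa0 b : 0 < p ^ b by rewrite expn_gt0 p0.
move=> /(unit_square_diffP _ _ (pa0 a)) [c pc xy]; apply/unit_square_diffP => //.
have {pc}pc : coprime p c by rewrite coprime_pexpl in pc.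
(* replacing [x] by a larger representative makes the difference exact *)
have [k kE] : exists k, x + (y + c ^ 2) * p ^ a.+1 = y + c ^ 2 + k * p ^ a.
  have le : y + c ^ 2 <= x + (y + c ^ 2) * p ^ a.+1.
    by apply: leq_trans (leq_addl _ _); rewrite leq_pmulr.
  have /dvdnP[k kE] : p ^ a %| x + (y + c ^ 2) * p ^ a.+1 - (y + c ^ 2).
    have /eqP D0 : p ^ a %| (y + c ^ 2) * p ^ a.+1 by rewrite (expnS p) mulnA dvdn_mull.
    by rewrite -eqn_mod_dvd // -(modnDmr x) D0 addn0 xy.
  by exists k; rewrite -kE subnKC.
have c0 : 0 < c.
  by case: (c) pc => //; rewrite /coprime gcdn0 => /eqP p1; rewrite p1 in pp.
have [||t tE] := @exists_modn_inv (2 * c) k p.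
- by rewrite coprimeMl coprime2n p2 coprime_sym.
- by rewrite muln_gt0.
exists (c + t * p ^ a).
  rewrite coprime_pexpl // -coprime_modr -modnDmr.
  by rewrite -(prednK a0) expnS mulnCA modnMr addn0 coprime_modr.
have -> : x = x + (y + c ^ 2) * p ^ a.+1 %[mod p ^ a.+1] by rewrite addnC modnMDl.
rewrite kE.
(* As [a > 0], the square of the correction is a multiple of [p ^ a.+1]. *)
have -> : y + (c + t * p ^ a) ^ 2 =
    t ^ 2 * p ^ a.-1 * p ^ a.+1 + (y + c ^ 2 + 2 * c * t * p ^ a).
  have -> : t ^ 2 * p ^ a.-1 * p ^ a.+1 = (t * p ^ a) ^ 2.
    by rewrite expnMn -mulnA -expnD -expnM; congr (_ * p ^ _); lia.
  by rewrite sqrnD; lia.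
rewrite modnMDl -modnDmr -[RHS]modnDmr; congr ((_ + _) %% _).
by rewrite expnS -!muln_modl ?tE // expn_gt0 p0.
Qed.

Lemma unit_square_diff_pow p a x y : prime p -> odd p -> 0 < a ->
  unit_square_diff (p ^ a) x y = unit_square_diff p x y.
Proof.
move=> pp p2; have p0 := prime_gt0 pp; case: a => // a _.
apply/idP/idP => [|h]; last by elim: a => [|a IH]; [rewrite expn1 | apply: hensel_step].
have pa0 : 0 < p ^ a.+1 by rewrite expn_gt0 p0.
move/(unit_square_diffP _ _ pa0) => [c]; rewrite coprime_pexpl // => pc xy.
apply/unit_square_diffP => //; exists c => //.
have dv : p %| p ^ a.+1 by rewrite dvdn_exp.
by rewrite -(modn_dvdm x dv) xy modn_dvdm.
Qed.

(** Vertices lie in ['I_n], which has one element for [n = 1], whereas ['Z_1] has two; the induction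
    over prime powers starts at this modulus. *)
Definition paley_tuples n m : nat :=
  #|ordered_cliques (fun x y : 'I_n => unit_square_diff n x y) m|.

Lemma paley_tuples1 m : paley_tuples 1 m = 1.
Proof.
rewrite /paley_tuples (_ : ordered_cliques _ m = setT).
  by rewrite cardsT card_ffun !card_ord exp1n.
apply/setP=> f; rewrite in_setT; apply/ordered_cliquesP=> i j _.
by apply/unit_square_diffP => //; exists 0; rewrite // !modn1.
Qed.

Lemma paley_tuples_mul m n k : 0 < m -> 0 < n -> coprime m n ->
  paley_tuples (m * n) k = paley_tuples m k * paley_tuples n k.
Proof.
move=> m0 n0 mn; rewrite /paley_tuples -card_ordered_cliques_prod.
have mn0 : 0 < m * n by rewrite muln_gt0 m0.
pose pi (x : 'I_(m * n)) := (Ordinal (ltn_pmod x m0), Ordinal (ltn_pmod x n0)).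
rewrite -[RHS]mul1n -(exp1n k).
apply: (card_ordered_cliques_fiber (pi := pi)) => [[b c]|x y].
  pose z := Ordinal (ltn_pmod (chinese m n b c) mn0).
  rewrite -(card1 z); apply: eq_card => x; rewrite !inE -!val_eqE /=.
  have := modn_small (ltn_ord x) => xE.
  rewrite -[in RHS]xE chinese_remainder // chinese_modl // chinese_modr //.
  by rewrite (modn_small (ltn_ord b)) (modn_small (ltn_ord c)) xpair_eqE -!val_eqE.
by rewrite unit_square_diff_mul //= !unit_square_diff_mod.
Qed.

(** Adjacency modulo [p ^ a] is pulled back from [p], and each residue modulo [p] has [p ^ a.-1]
    lifts. *)
Lemma paley_tuples_pow p a k : prime p -> odd p -> 0 < a ->
  paley_tuples (p ^ a) k = p ^ (a.-1 * k) * paley_tuples p k.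
Proof.
move=> pp p2 a0; have p0 := prime_gt0 pp.
have pE : p ^ a = p ^ a.-1 * p by rewrite -expnSr prednK.
pose pi (x : 'I_(p ^ a)) := Ordinal (ltn_pmod x p0).
rewrite /paley_tuples expnM.
apply: (card_ordered_cliques_fiber (pi := pi)) => [b|x y].
  have lt (t : 'I_(p ^ a.-1)) : b + t * p < p ^ a.
    rewrite pE; apply: leq_trans (_ : t.+1 * p <= _).
      by rewrite mulSn ltn_add2r.
    by rewrite leq_pmul2r.
  pose h t := Ordinal (lt t).
  have h_inj : injective h.
    move=> s t /(congr1 val) /= /addnI /eqP; rewrite eqn_pmul2r // => /eqP.
    exact: val_inj.
  rewrite -[RHS]card_ord -(card_imset _ h_inj); apply: eq_card => x; rewrite inE.
  apply/eqP/imsetP => [xb|[t _ ->]]; last first.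
    by apply: val_inj; rewrite /= addnC modnMDl modn_small.
  have xlt : x %/ p < p ^ a.-1.
    by rewrite ltn_divLR // -pE.
  exists (Ordinal xlt) => //; apply: val_inj => /=.
  by rewrite -xb /= addnC -divn_eq.
by rewrite unit_square_diff_pow //= unit_square_diff_mod.
Qed.

Lemma card_ordered_cliques_paley n m : 1 < n ->
  #|ordered_cliques (@paley_type_graph n) m| = paley_tuples n m.
Proof.
case: n => [|[|n]] // _.
have E (x y : 'Z_n.+2) : paley_type_graph x y = unit_square_diff n.+2 x y.
  apply: eq_existsb => c; congr (_ && _).
  by rewrite subr_eq addrC -val_eqE /= modnDmr (@modn_small x) ?ltn_ord.
by apply: eq_card => f; apply/ordered_cliquesP/ordered_cliquesP => h i j /h; rewrite E.
Qed.

End UnitSquareDifferences.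

(** * Uniqueness of the even term in a sum of two squares *)

Lemma sum_two_squares_unique_dvd (p : nat) (a b c d : int) : (0 < p)%N ->
  p%:Z = a ^+ 2 + b ^+ 2 -> p%:Z = c ^+ 2 + d ^+ 2 -> (p %| a * c + b * d)%Z ->
  a ^+ 2 = c ^+ 2 \/ p%:Z = a ^+ 2 + c ^+ 2.
Proof.
move=> p0; set P := p%:Z => ab cd /dvdzP[m X].
have P0 : 0 < P by [].
have P0' : P != 0 by rewrite gt_eqF.
(* By [(ac + bd)^2 + (ad - bc)^2 = (a^2 + b^2) (c^2 + d^2)], [m ^+ 2] is at most 1. The case [m = 0]
   gives [P = a^2 + c^2]; otherwise [ad = bc], which gives [a^2 = c^2]. *)
have X2 : m ^+ 2 * P ^+ 2 + (a * d - b * c) ^+ 2 = P ^+ 2.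
  by rewrite -exprMn -X [RHS]expr2 {1}ab cd; ring.
have bE : b ^+ 2 = P - a ^+ 2 by rewrite ab addrC addKr.
have dE : d ^+ 2 = P - c ^+ 2 by rewrite cd addrC addKr.
have m1 : m ^+ 2 <= 1.
  rewrite -(ler_pM2r (exprn_gt0 2 P0)) mul1r; have := sqr_ge0 (a * d - b * c); lra.
have [m0|m0] := eqVneq m 0.
  right; apply/(mulfI P0').
  have bd : (a * c) ^+ 2 = (b * d) ^+ 2.
    move: X; rewrite m0 mul0r => /eqP; rewrite addr_eq0 => /eqP ->; exact: sqrrN.
  have : a ^+ 2 * c ^+ 2 = (P - a ^+ 2) * (P - c ^+ 2) by rewrite -bE -dE -!exprMn.
  by move=> h; apply/eqP; rewrite -subr_eq0; apply/eqP; lra.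
left; apply/(mulfI P0').
have mE : m ^+ 2 = 1.
  by apply/eqP; rewrite eq_le m1 -gtz0_ge1 exprn_even_gt0.
have adbc : a * d = b * c.
  move: X2; rewrite mE mul1r -[RHS]addr0 => /addrI Y0.
  by apply/eqP; rewrite -subr_eq0 -sqrf_eq0 Y0.
have : a ^+ 2 * (P - c ^+ 2) = (P - a ^+ 2) * c ^+ 2 by rewrite -bE -dE -!exprMn adbc.
by move=> h; lra.
Qed.

(** The prime divides [(ac + bd) (ac - bd)], hence one factor, and the sign of [d] exchanges the
    two. Parity excludes [p = a^2 + c^2]. *)
Lemma sum_two_squares_unique (p : nat) (a b c d : int) : prime p -> odd p ->
  p%:Z = a ^+ 2 + b ^+ 2 -> p%:Z = c ^+ 2 + d ^+ 2 ->
  (2 %| a)%Z -> (2 %| c)%Z -> a ^+ 2 = c ^+ 2.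
Proof.
move=> pp podd ab cd /dvdzP[a' aE] /dvdzP[c' cE].
have nr : p%:Z <> a ^+ 2 + c ^+ 2.
  by rewrite aE cE => h; move: podd; lia.
have : (p %| (a * c + b * d) * (a * c + b * - d))%Z.
  apply/dvdzP; exists (a ^+ 2 + c ^+ 2 - p%:Z).
  have bE : b ^+ 2 = p%:Z - a ^+ 2 by rewrite ab addrC addKr.
  have dE : d ^+ 2 = p%:Z - c ^+ 2 by rewrite cd addrC addKr.
  by transitivity (a ^+ 2 * c ^+ 2 - b ^+ 2 * d ^+ 2); [ring | rewrite bE dE; ring].
rewrite dvdzE abszM Euclid_dvdM // -!dvdzE => /orP[] h.
  by have [] := sum_two_squares_unique_dvd (prime_gt0 pp) ab cd h.
have cd' : p%:Z = c ^+ 2 + (- d) ^+ 2 by rewrite sqrrN.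
by have [] := sum_two_squares_unique_dvd (prime_gt0 pp) ab cd' h.
Qed.

(** * Evaluation at a prime and assembly over the prime factors *)

Lemma card_Fp_ordered_cliques (p : nat) : prime p -> (p = 1 %[mod 4])%N ->
  (paley_tuples p 4)%:R = sqind4 'F_p.
Proof.
move=> pp p4.
have q4 : (#|'F_p| = 1 %[mod 4])%N by rewrite card_Fp.
(* ['F_p] is by definition ['Z_(pdiv p)], so at modulus [pdiv p] the vertices form the field. *)
have -> : paley_tuples p 4 = #|ordered_cliques (@paley_type_graph (pdiv p)) 4|.
  by rewrite card_ordered_cliques_paley pdiv_id ?prime_gt1.
have E (x y : 'F_p) : paley_type_graph x y = (qchar (x - y) == 1).
  apply/existsP/eqP => [[c /andP[cU /eqP ->]]|/qchar1_sqr[c c0 ->]].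
    by rewrite (qchar_of_sqr q4) -unitfE cU.
  by exists c; rewrite unitfE c0 eqxx.
rewrite card_ordered_cliques4 => [|x y]; last by rewrite !E (qchar_subC q4).
rewrite /sqind4 natr_sum; apply: eq_bigr => x _.
rewrite natr_sum; apply: eq_bigr => y _.
rewrite natr_sum; apply: eq_bigr => z _.
rewrite natr_sum; apply: eq_bigr => w _.
by rewrite !E -!mulnb !natrM /sqind !mulrA.
Qed.

Lemma paley_tuples_prime (p : nat) (a b : int) : prime p -> (p = 1 %[mod 4])%N ->
  p%:Z = a ^+ 2 + b ^+ 2 -> (2 %| a)%Z ->
  64 * (paley_tuples p 4)%:R =
  p%:Z * (p%:Z - 1) * ((p%:Z - 9) ^+ 2 - 4 * a ^+ 2).
Proof.
move=> pp p4 ab a2; have podd : odd p by lia.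
have q4 : (#|'F_p| = 1 %[mod 4])%N by rewrite card_Fp.
rewrite card_Fp_ordered_cliques //.
have [c [d [cd J]]] := legendre_moment_eval q4.
have S4 := sqind4E q4; have M := common_nbr_edgesE q4.
rewrite card_Fp // natz in cd J S4 M.
have c2 : (2 %| 2 * c)%Z by rewrite dvdz_mulr.
(* [2 * c] is the even term produced by the Jacobsthal sums; uniqueness gives
   [a ^+ 2 = (2 * c) ^+ 2]. *)
rewrite (sum_two_squares_unique pp podd ab cd a2 c2).
rewrite (_ : 64 * _ = 32 * (2 * sqind4 'F_p)); last by ring.
rewrite S4 mulrCA M J; ring.
Qed.

Lemma paley_tuples_prod (I : eqType) (s : seq I) (p alpha : I -> nat) m :
  uniq s -> injective p ->
  (forall i, prime (p i)) -> (forall i, odd (p i)) -> (forall i, 0 < alpha i)%N ->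
  (0 < \prod_(i <- s) p i ^ alpha i)%N /\
  paley_tuples (\prod_(i <- s) p i ^ alpha i) m =
  (\prod_(i <- s) (p i ^ ((alpha i).-1 * m) * paley_tuples (p i) m))%N.
Proof.
move=> us pinj pp podd a0; elim: s us => [|i s IH] /=.
  by rewrite !big_nil paley_tuples1.
case/andP => is_ us; have [s0 IHs] := IH us; rewrite !big_cons.
have pi0 : (0 < p i ^ alpha i)%N by rewrite expn_gt0 prime_gt0.
split; first by rewrite muln_gt0 pi0.
rewrite paley_tuples_mul // ?IHs ?paley_tuples_pow //.
rewrite coprime_sym big_seq; elim/big_ind: _ => [|x y xc yc|j js].
- by rewrite coprime1n.
- by rewrite coprimeMl xc yc.
apply/coprimeXl/coprimeXr; rewrite prime_coprime // dvdn_prime2 // (inj_eq pinj).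
by apply: contraNneq is_ => <-.
Qed.

Theorem theorem1p3 (k n : nat) (p alpha : 'I_k -> nat) (a b : 'I_k -> int)
  (hk : (1 <= k)%N)
  (hn : n = (\prod_(i < k) p i ^ alpha i)%N)
  (halpha : forall i, (1 <= alpha i)%N)
  (hp : forall i, prime (p i))
  (hp_distinct : injective p)
  (hp_mod4 : forall i, (p i = 1 %[mod 4])%N)
  (hab : forall i, (p i)%:Z = a i ^+ 2 + b i ^+ 2)
  (ha_even : forall i, (2 %| a i)%Z) :
  (num_cliques (@paley_type_graph n) 4)%:R =
    1 / (3 * 8 ^+ (2 * k + 1)) *
    \prod_(i < k)
      ((p i)%:R ^+ (4 * alpha i - 3) * ((p i)%:R - 1) *
       (((p i)%:R - 9) ^+ 2 - 4 * (a i)%:~R ^+ 2)) :> rat.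
Proof.
have podd i : odd (p i) by have := hp_mod4 i; lia.
have [_] := paley_tuples_prod 4 (index_enum_uniq _) hp_distinct hp podd halpha.
rewrite -hn => tE.
(* A prime factor exists because [k >= 1]; this puts [n] in the range where ['Z_n] is Z/nZ. *)
have n1 : (1 < n)%N.
  rewrite hn (bigD1 (Ordinal hk)) //=; set P := (\prod_(i < k | _) _)%N.
  have P0 : (0 < P)%N by apply: prodn_gt0 => i; rewrite expn_gt0 prime_gt0.
  apply: leq_trans (leq_pmulr _ P0); apply: leq_trans (prime_gt1 (hp (Ordinal hk))) _.
  by rewrite -{1}[p _]expn1 leq_pexp2l // prime_gt0.
have eI : irreflexive (@paley_type_graph n).
  move=> x; apply/existsP=> -[c /andP[cU]]; rewrite subrr eq_sym => /eqP c0.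
  by have := unitrX 2 cU; rewrite c0 unitr0.
have := card_ordered_cliques 4 eI; rewrite card_ordered_cliques_paley // tE.
move=> /(congr1 (fun N : nat => N%:R : rat)); rewrite natrM natr_prod => cE.
have -> : (num_cliques (@paley_type_graph n) 4)%:R =
    \prod_(i < k) (p i ^ ((alpha i).-1 * 4) * paley_tuples (p i) 4)%N%:R / 24 :> rat.
  by rewrite cE mulfK.
(* [3 * 8 = 4!] accounts for the orderings of a clique, and [8 ^+ (2 * k)] for the factor 64 of
   [paley_tuples_prime] at each prime. *)
rewrite (_ : 3 * 8 ^+ (2 * k + 1) = 24 * 64 ^+ k); last first.
  by rewrite exprD expr1 exprM -natrX; ring.
rewrite [X in _ = _ * X](eq_bigr (fun i : 'I_k =>
  64 * (p i ^ ((alpha i).-1 * 4) * paley_tuples (p i) 4)%N%:R)) => [|i _].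
  rewrite big_split /= prodr_const card_ord.
  set Q := \prod_i _; have : 64 ^+ k != 0 :> rat by rewrite expf_neq0.
  by move=> k0; field.
have := paley_tuples_prime (hp i) (hp_mod4 i) (hab i) (ha_even i).
move=> /(congr1 (fun z : int => z%:~R : rat)).
rewrite !(rmorphM, rmorphB, rmorphXn) /= !rmorph_nat => E.
rewrite [RHS]mulrCA E -!pmulrn.
(* Lifting contributes [4 * (alpha i - 1)] factors [p i] and the count over the field one more;
   [alpha i >= 1] keeps the truncated subtractions exact. *)
rewrite (_ : (4 * alpha i - 3 = (alpha i).-1 * 4 + 1)%N); last by have := halpha i; lia.
by rewrite exprD expr1; ring.
Qed.
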